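(* Let $n_x,n_u\ge 1$ be integers, and let $A\in\mathbb{R}^{n_x\times n_x}$ and $B\in\mathbb{R}^{n_x\times n_u}$. The linear time-invariant system $$\dot x = Ax+Bu,\qquad \dot x_{\mathrm{wo}} = u,$$ with state $(x,x_{\mathrm{wo}})\in\mathbb{R}^{n_x}\times\mathbb{R}^{n_u}$ and input $u\in\mathbb{R}^{n_u}$, is controllable if and only if the system $\dot x=Ax+Bu$ (with state $x\in\mathbb{R}^{n_x}$ and input $u\in\mathbb{R}^{n_u}$) is controllable and the matrix $A$ is regular (i.e. invertible).
   Context: A linear constant-coefficient system $\dot z = Mz+Nu$ with $M\in\mathbb{R}^{n\times n}$, $N\in\mathbb{R}^{n\times m}$ is called controllable if its controllability matrix $[N, MN,\ldots,M^{n-1}N]\in\mathbb{R}^{n\times nm}$ has full rank $n$. For the extended system, $n=n_x+n_u$, $m=n_u$, $M=\begin{bmatrix}A&0\\0&0\end{bmatrix}$ and $N=\begin{bmatrix}B\\ I_{n_u}\end{bmatrix}$. *)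

(* Defs.v *)
From mathcomp Require Import all_boot all_order all_algebra.
From mathcomp Require Import reals.

Set Implicit Arguments.
Unset Strict Implicit.
Unset Printing Implicit Defensive.

Import GRing.Theory.
Local Open Scope ring_scope.

(* A system z' = M z + N u is represented by the pair (M, N); states and
   inputs are column vectors. *)

(* [N, M N, ..., M^(n-1) N]; its number of columns is
   \sum_(k < n) m, which is equal (not convertible) to n * m. *)
Definition controllability_mx (R : realType) (n m : nat)
    (M : 'M[R]_n) (N : 'M[R]_(n, m)) : 'M[R]_(n, \sum_(k < n) m) :=
  \mxrow_(k < n) (M ^+ k *m N).

Definition controllable (R : realType) (n m : nat)
    (M : 'M[R]_n) (N : 'M[R]_(n, m)) : Prop :=
  \rank (controllability_mx M N) = n.

(* x' = A x + B u, xwo' = u, with state col_mx x xwo; see extended_systemE. *)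
Definition extended_state_mx (R : realType) (nx nu : nat)
    (A : 'M[R]_nx) : 'M[R]_(nx + nu) :=
  block_mx A 0 0 0.

Definition extended_input_mx (R : realType) (nx nu : nat)
    (B : 'M[R]_(nx, nu)) : 'M[R]_(nx + nu, nu) :=
  col_mx B 1%:M.

Lemma extended_systemE (R : realType) (nx nu : nat)
    (A : 'M[R]_nx) (B : 'M[R]_(nx, nu))
    (x : 'cV[R]_nx) (xwo u : 'cV[R]_nu) :
  extended_state_mx nu A *m col_mx x xwo + extended_input_mx B *m u
  = col_mx (A *m x + B *m u) u.
Proof.
rewrite /extended_state_mx /extended_input_mx mul_block_col mul_col_mx.
by rewrite add_col_mx !mul0mx !addr0 add0r mul1mx.
Qed.

(* Main.v *)
Require Import Defs.
From mathcomp Require Import all_boot all_order all_algebra.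
From mathcomp Require Import reals.

(** The pair (M, N) is controllable iff 0 is the only row vector v such that
    v M^k N = 0 for all k; by Cayley-Hamilton the powers k < n suffice. For the
    extended pair and v = (a, b), the equation for k = 0 reads b = - a B and
    those for k >= 1 read (a A) A^(k-1) B = 0, so the extended pair is
    controllable iff the map a |-> a A is injective and (A, B) is controllable. *)

Set Implicit Arguments.
Unset Strict Implicit.
Unset Printing Implicit Defensive.

Import GRing.Theory.
Local Open Scope ring_scope.

(** Serves twice: for the rank of the controllability matrix and for the invertibility of [A]. *)
Lemma row_free_kerP (F : fieldType) (m n : nat) (C : 'M[F]_(m, n)) :
  row_free C <-> forall v : 'rV_m, v *m C = 0 -> v = 0.
Proof.
split=> [freeC v vC0 | kerC].
  by apply: (row_free_inj freeC); rewrite vC0 mul0mx.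
rewrite -kermx_eq0; apply/eqP/row_matrixP => i; rewrite row0.
by apply: kerC; apply/sub_kermxP/row_sub.
Qed.

Lemma exp_mx_annihil (F : fieldType) (n m : nat) (M : 'M[F]_n)
    (N : 'M[F]_(n, m)) (v : 'rV_n) :
  (forall k : 'I_n, v *m (M ^+ k *m N) = 0) ->
  forall k, v *m (M ^+ k *m N) = 0.
Proof.
case: n => [|n] in M N v *; first by move=> _ k; rewrite (thinmx0 v) mul0mx.
move=> vMN0 k.
(* Divide ['X^k] by [char_poly M] and evaluate at [M]: the multiple of [char_poly M] vanishes by
   Cayley-Hamilton. *)
have -> : M ^+ k = horner_mx M ('X^k %% char_poly M).
  rewrite -{1}(horner_mx_X M) -rmorphXn /= {1}(divp_eq 'X^k (char_poly M)).
  by rewrite rmorphD rmorphM /= Cayley_Hamilton mulr0 add0r.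
set r := (_ %% _).
(* The dimension is [n.+1] here, so only exponents below it occur in [r], and [vMN0] covers them
   all. *)
have size_r : (size r <= n.+1)%N.
  by rewrite -ltnS -(size_char_poly M) ltn_modp monic_neq0 // char_poly_monic.
rewrite -[r]coefK poly_def rmorph_sum mulmx_suml mulmx_sumr /= big1 // => i _.
rewrite linearZ /= rmorphXn /= horner_mx_X -scalemxAl -scalemxAr.
by rewrite (vMN0 (widen_ord size_r i)) scaler0.
Qed.

(** Letting [k] range over all naturals frees the criterion from the dimension, so pairs of sizes
    [nx + nu] and [nx] can be compared. *)
Lemma controllableP (R : realType) (n m : nat) (M : 'M[R]_n)
    (N : 'M[R]_(n, m)) :
  controllable M N <->
  forall v : 'rV_n, (forall k, v *m (M ^+ k *m N) = 0) -> v = 0.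
Proof.
have -> : controllable M N <-> row_free (controllability_mx M N).
  by split=> /eqP.
rewrite row_free_kerP /controllability_mx.
split=> kerC v vMN0; apply: kerC.
  by rewrite mul_mxrow -mxrow0; apply/eq_mxrowP => k.
apply: exp_mx_annihil => k.
by move: vMN0; rewrite mul_mxrow -mxrow0 => /eq_mxrowP.
Qed.

(** One application of the state matrix wipes out the lower block, which is the identity at exponent
    0; hence the shift to [k.+1]. *)
Lemma extended_expS (R : realType) (nx nu : nat) (A : 'M[R]_nx)
    (B : 'M[R]_(nx, nu)) (k : nat) :
  extended_state_mx nu A ^+ k.+1 *m extended_input_mx B =
  col_mx (A ^+ k.+1 *m B) 0.
Proof.
have step (C : 'M_(nx, nu)) (D : 'M_nu) :
    extended_state_mx nu A *m col_mx C D = col_mx (A *m C) 0.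
  by rewrite mul_block_col !mul0mx !addr0.
elim: k => [|k IHk]; first by rewrite !expr1 step.
by rewrite exprS -mulmxA IHk step [A ^+ k.+2]exprS mulmxA.
Qed.

Lemma extended_controllableP (R : realType) (nx nu : nat) (A : 'M[R]_nx)
    (B : 'M[R]_(nx, nu)) :
  controllable (extended_state_mx nu A) (extended_input_mx B) <->
  forall a : 'rV_nx, (forall k, a *m (A ^+ k.+1 *m B) = 0) -> a = 0.
Proof.
rewrite controllableP; split=> [ext0 a aAB0 | ker0 v].
  (* The second block is the one forced by the equation at exponent 0. *)
  suff /eqP : row_mx a (- (a *m B)) = 0 by rewrite row_mx_eq0 => /andP[/eqP].
  apply: ext0 => -[|k];
    last by rewrite extended_expS mul_row_col aAB0 mulmx0 addr0.
  by rewrite expr0 mul1mx mul_row_col mulmx1 subrr.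
rewrite -[v]hsubmxK => vMN0.
have a0 : lsubmx v = 0.
  apply: ker0 => k; move: (vMN0 k.+1).
  by rewrite extended_expS mul_row_col mulmx0 addr0.
move: (vMN0 0); rewrite expr0 mul1mx mul_row_col mulmx1 a0 mul0mx add0r => ->.
by rewrite row_mx0.
Qed.

Theorem lemma3p1 (R : realType) (nx nu : nat)
    (hnx : (1 <= nx)%N) (hnu : (1 <= nu)%N)
    (A : 'M[R]_nx) (B : 'M[R]_(nx, nu)) :
  controllable (extended_state_mx nu A) (extended_input_mx B)
  <-> controllable A B /\ A \in unitmx.
Proof.
have expSr_mulmx (a : 'rV_nx) k :
    a *m (A ^+ k.+1 *m B) = a *m A *m (A ^+ k *m B).
  by rewrite exprS -!mulmxA.
rewrite extended_controllableP controllableP -row_free_unit row_free_kerP.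
split=> [ker0 | [kerAB kerA] a aAB0].
  (* For [(A, B)] the hypothesis is used at [k.+1]; for [A], the leading factor [a *m A] is already
     zero. *)
  split=> a a0; apply: ker0 => k; first exact: a0.
  by rewrite expSr_mulmx a0 mul0mx.
by apply/kerA/kerAB => k; rewrite -expSr_mulmx.
Qed.
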